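(* Let $X$ be a normal ($T_4$) topological space. If $I$ is any proper ideal in $B_1^*(X)$, then $E_B(I)$ is an $e_B$-filter on $X$.
   Context: A Baire one function on $X$ is a function $f:X\to\mathbb{R}$ that is the pointwise limit of a sequence of continuous real-valued functions on $X$. $B_1(X)$ is the ring, under pointwise operations, of all Baire one functions on $X$, and $B_1^*(X)$ is its subring of bounded functions. For $f\in B_1(X)$, $Z(f)=\{x\in X: f(x)=0\}$, and $Z(B_1(X))=\{Z(f): f\in B_1(X)\}$. A $Z_B$-filter on $X$ is a nonempty $\mathscr F\subseteq Z(B_1(X))$ such that (1) $\emptyset\notin\mathscr F$; (2) $Z_1,Z_2\in\mathscr F$ implies $Z_1\cap Z_2\in\mathscr F$; (3) $Z\in\mathscr F$, $Z'\in Z(B_1(X))$ and $Z\subseteq Z'$ imply $Z'\in\mathscr F$. For $f\in B_1^*(X)$ and $\epsilon>0$, $E_B^\epsilon(f)=\{x\in X: |f(x)|\le\epsilon\}$ (a member of $Z(B_1(X))$). For nonempty $I\subseteq B_1^*(X)$, $E_B(I)=\{E_B^\epsilon(f): f\in I,\ \epsilon>0\}$. For $\mathscr F\subseteq Z(B_1(X))$, $E_B^{-1}(\mathscr F)=\{f\in B_1^*(X): E_B^\epsilon(f)\in\mathscr F\text{ for all }\epsilon>0\}$. A $Z_B$-filter $\mathscr F$ is an $e_B$-filter if $\mathscr F=E_B(E_B^{-1}(\mathscr F))$. *)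

(* Defs.v *)
From mathcomp Require Import all_boot all_order all_algebra.
From mathcomp Require Import all_classical all_reals all_analysis.
Set Implicit Arguments.
Unset Strict Implicit.
Unset Printing Implicit Defensive.
Import Order.TTheory GRing.Theory Num.Theory.
Import numFieldNormedType.Exports.
Local Open Scope classical_set_scope.
Local Open Scope ring_scope.

(* normal_space alone does not require points to be closed. *)
Definition T4_space (X : topologicalType) : Prop :=
  accessible_space X /\ normal_space X.

Section BaireOne.
Variables (R : realType) (X : topologicalType).
Implicit Types (f g h : X -> R) (I : set (X -> R)) (F : set (set X)).

Definition baire1 : set (X -> R) :=
  [set f | exists u : nat -> X -> R,
     (forall n, continuous (u n)) /\
     (forall x, u n x @[n --> \oo] --> f x)].

Definition baire1_bounded : set (X -> R) :=
  [set f | baire1 f /\ bounded_fun f].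

Definition zero_set f : set X := [set x | f x = 0].

Definition baire1_zero_sets : set (set X) := zero_set @` baire1.

(* MathComp's idealr concerns decidable predicates on a nonzero ring; here the
   ring baire1_bounded is a set of functions, and it is the zero ring if X is
   empty. *)
Definition is_ideal I : Prop :=
  [/\ I `<=` baire1_bounded,
      I (fun=> 0),
      (forall f g, I f -> I g -> I (f \- g)) &
      (forall h f, baire1_bounded h -> I f -> I (h \* f))].

Definition is_proper_ideal I : Prop := is_ideal I /\ I <> baire1_bounded.

Definition ZB_filter F : Prop :=
  [/\ F `<=` baire1_zero_sets /\ F !=set0,
      ~ F set0,
      (forall Z1 Z2, F Z1 -> F Z2 -> F (Z1 `&` Z2)) &
      (forall Z Z', F Z -> baire1_zero_sets Z' -> Z `<=` Z' -> F Z')].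

Definition EB_eps (eps : R) f : set X := [set x | `|f x| <= eps].

Definition EB I : set (set X) :=
  [set EB_eps eps f | f in I & eps in [set e : R | 0 < e]].

Definition EB_inv F : set (X -> R) :=
  [set f | baire1_bounded f /\ forall eps : R, 0 < eps -> F (EB_eps eps f)].

Definition eB_filter F : Prop := ZB_filter F /\ F = EB (EB_inv F).

End BaireOne.

Arguments baire1 : clear implicits.
Arguments baire1_bounded : clear implicits.
Arguments baire1_zero_sets : clear implicits.
Arguments ZB_filter R [X] F.
Arguments EB_inv R [X] F.
Arguments eB_filter R [X] F.

(* Main.v *)
Require Import Defs.
From mathcomp Require Import all_boot all_order all_algebra.
From mathcomp Require Import all_classical all_reals all_analysis.
Import Order.TTheory GRing.Theory Num.Theory numFieldNormedType.Exports.
Local Open Scope classical_set_scope.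
Local Open Scope ring_scope.

(** Everything rests on [EB_superset]: if [h] is Baire one and vanishes on [EB_eps eps f] with [f]
    in [I], then [zero_set h] is exactly [EB_eps eps (g \* f)] for a suitable bounded Baire one [g].
    This gives upward closure, and reduces closure under intersection to finding one member of
    [EB I] inside [Z1]&[Z2]. The empty set is excluded because it would make some element of [I] a
    unit. Finally [I] lies in [EB_inv R (EB I)], which gives one inclusion of the [eB_filter]
    equation; the other is the definition of [EB_inv]. *)

Lemma bounded_funE {R : realType} {T : Type} (f : T -> R) :
  bounded_fun f <-> exists M : R, forall x, `|f x| <= M.
Proof.
split=> [[M [_ fM]]|[M fM]].
  by exists (M + 1) => x; apply: fM => //; rewrite ltrDl.
by exists M; split=> [|y /ltW My x _]; [exact: num_real|exact: le_trans My].
Qed.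

Lemma continuous_maxr {R : realType} (c : R) :
  continuous (fun t : R => Num.max t c).
Proof. by move=> t; apply: continuous_max; [exact: cvg_id|exact: cvg_cst]. Qed.

(** The continuous approximants of a nonvanishing Baire one function may vanish, so [baire1_comp]
    needs a reciprocal that is continuous on the whole line. *)
Lemma continuous_inv_maxr {R : realType} (c : R) : 0 < c ->
  continuous (fun t : R => (Num.max t c)^-1).
Proof.
move=> c0 t; apply: cvgV; last exact: continuous_maxr.
by rewrite gt_eqF// lt_max c0 orbT.
Qed.

Section BaireOneRing.
Context {R : realType} {X : topologicalType}.
Implicit Types (f g h : X -> R) (I : set (X -> R)).

Lemma baire1_cst (c : R) : baire1 R X (fun=> c).
Proof.
by exists (fun _ _ => c); split=> [_|_]; [exact: cst_continuous|exact: cvg_cst].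
Qed.

Lemma baire1_comp (phi : R -> R) f :
  continuous phi -> baire1 R X f -> baire1 R X (phi \o f).
Proof.
move=> cphi [u [cu uf]]; exists (fun n => phi \o u n); split=> [n x|x].
  by apply: continuous_comp; [exact: cu|exact: cphi].
by apply: continuous_cvg; [exact: cphi|exact: uf].
Qed.

Lemma baire1D f g : baire1 R X f -> baire1 R X g -> baire1 R X (f \+ g).
Proof.
move=> [u [cu uf]] [v [cv vg]]; exists (fun n => u n \+ v n).
by split=> [n x|x]; apply: cvgD; [exact: cu|exact: cv|exact: uf|exact: vg].
Qed.

Lemma baire1M f g : baire1 R X f -> baire1 R X g -> baire1 R X (f \* g).
Proof.
move=> [u [cu uf]] [v [cv vg]]; exists (fun n => u n \* v n).
by split=> [n x|x]; apply: cvgM; [exact: cu|exact: cv|exact: uf|exact: vg].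
Qed.

Lemma baire1_norm f : baire1 R X f -> baire1 R X (fun x => `|f x|).
Proof. by apply: baire1_comp => t; exact: norm_continuous. Qed.

Lemma zero_set_EB_eps (eps : R) f :
  baire1 R X f -> baire1_zero_sets R X (EB_eps eps f).
Proof.
move=> bf; exists (fun x => Num.max (`|f x| + - eps) 0).
  apply: (@baire1_comp (fun t => Num.max t 0) (fun x => `|f x| + - eps)).
    exact: continuous_maxr.
  by apply: baire1D; [exact: baire1_norm|exact: baire1_cst].
apply/seteqP; split=> x; rewrite /zero_set /EB_eps /= -subr_le0.
  by move=> <-; rewrite le_max lexx.
by move/max_idPr.
Qed.

Lemma idealD I f g : is_ideal I -> I f -> I g -> I (f \+ g).
Proof.
case=> _ I0 IB _ If Ig.
rewrite (_ : f \+ g = f \- ((fun=> 0) \- g)); first by apply: (IB) => //; exact: IB.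
by apply/funext => x /=; rewrite sub0r opprK.
Qed.

(* If [f] stays away from 0, it is invertible in the ring of bounded Baire one
   functions. *)
Lemma EB_eps_neq0 I f (eps : R) : is_proper_ideal I -> I f -> 0 < eps ->
  EB_eps eps f <> set0.
Proof.
move=> [[IB I0 ID IM] Iproper] If eps0 Ef0; apply: Iproper.
have fgt x : eps < `|f x|.
  by rewrite ltNge; apply/negP => fx; have : set0 x by rewrite -Ef0.
have [bf _] := IB _ If.
(* This is [f / f^2]: the cutoff changes no value, as [|f|] exceeds [eps], but makes the reciprocal
   a continuous function of [f \* f]. *)
pose k x := f x * (Num.max (f x * f x) (eps * eps))^-1.
have kE x : k x = (f x)^-1.
  have ff : eps * eps <= f x * f x.
    rewrite -[leRHS]ger0_norm ?normrM; last by rewrite -expr2 sqr_ge0.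
    by rewrite ler_pM // ltW.
  rewrite /k (max_idPl ff) invfM mulrA divff ?mul1r// -normr_gt0.
  exact: lt_trans (fgt x).
have bk : baire1 R X k.
  apply: baire1M => //.
  apply: (@baire1_comp (fun t => (Num.max t (eps * eps))^-1) (f \* f)).
    by apply: continuous_inv_maxr; rewrite mulr_gt0.
  exact: baire1M.
apply/seteqP; split=> [//|h [bh /bounded_funE[M hM]]].
rewrite (_ : h = (h \* k) \* f).
  apply: IM => //; split; first exact: baire1M.
  apply/bounded_funE; exists (M * eps^-1) => x /=.
  rewrite normrM ler_pM// kE normfV lef_pV2 ?posrE//; first exact: ltW.
  exact: lt_trans (fgt x).
apply/funext => x /=; rewrite kE mulfVK // -normr_gt0.
exact: lt_trans (fgt x).
Qed.

(* With [g = (eps + min (|h|, 1)) / max (|f|, eps)], one has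
   [|f g| = |f| <= eps] on [EB_eps eps f], which is included in the zero set of
   [h], and [|f g| = eps + min (|h|, 1)] elsewhere. *)
Lemma EB_superset I f h (eps : R) : is_ideal I -> I f -> 0 < eps ->
  baire1 R X h -> EB_eps eps f `<=` zero_set h -> EB I (zero_set h).
Proof.
move=> [IB I0 ID IM] If eps0 bh Efh.
have [bf _] := IB _ If.
pose g x := (eps + Num.min `|h x| 1) * (Num.max `|f x| eps)^-1.
have m0 x : 0 <= Num.min `|h x| 1 by rewrite le_min normr_ge0 ler01.
have g0 x : 0 <= g x.
  rewrite mulr_ge0 ?invr_ge0//; first by rewrite addr_ge0// ltW.
  by rewrite le_max normr_ge0.
have bg : baire1 R X g.
  apply: (@baire1M (fun x => eps + Num.min `|h x| 1)
                   (fun x => (Num.max `|f x| eps)^-1)).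
    apply: (@baire1D (fun=> eps) (fun x => Num.min `|h x| 1)).
      exact: baire1_cst.
    apply: (@baire1_comp (fun t => Num.min t 1) (fun x => `|h x|)).
      by move=> t; apply: continuous_min; [exact: cvg_id|exact: cvg_cst].
    exact: baire1_norm.
  apply: (@baire1_comp (fun t => (Num.max t eps)^-1) (fun x => `|f x|)).
    exact: continuous_inv_maxr.
  exact: baire1_norm.
exists (g \* f).
  apply: IM => //; split=> //; apply/bounded_funE.
  (* Truncating [|h|] at 1 bounds the numerator of [g]; its denominator is at least [eps]. *)
  exists ((eps + 1) * eps^-1) => x; rewrite ger0_norm// /g.
  rewrite ler_pM ?invr_ge0//; first by rewrite addr_ge0// ltW.
  - by rewrite le_max normr_ge0.
  - by rewrite lerD2l ge_min lexx orbT.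
  - by rewrite lef_pV2 ?posrE ?lt_max ?le_max ?eps0 ?lexx ?orbT.
exists eps => //; apply/seteqP; split=> x; rewrite /EB_eps /zero_set /=.
  rewrite normrM (ger0_norm (g0 x)) => gf.
  have [/Efh//|ef] := leP `|f x| eps.
  move: gf; rewrite /g (max_idPl (ltW ef)) mulfVK ?gt_eqF//; last first.
    exact: lt_trans ef.
  by rewrite gerDl ge_min ler10 orbF normr_le0 => /eqP.
(* Where [h] vanishes, the product has absolute value [eps * |f| / max (|f|, eps)]. *)
move=> hx; rewrite normrM (ger0_norm (g0 x)) /g hx normr0.
rewrite (min_idPl ler01) addr0.
have M0 : 0 < Num.max `|f x| eps by rewrite lt_max eps0 orbT.
by rewrite -mulrA ger_pMr// mulrC ler_pdivrMr// mul1r le_max lexx.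
Qed.

Lemma EB_baire1_zero_sets I : is_ideal I -> EB I `<=` baire1_zero_sets R X.
Proof.
by move=> [IB _ _ _] _ [f /IB[bf _]] [eps _ <-]; exact: zero_set_EB_eps.
Qed.

Lemma baire1_zero_setsI (Z1 Z2 : set X) : baire1_zero_sets R X Z1 ->
  baire1_zero_sets R X Z2 -> baire1_zero_sets R X (Z1 `&` Z2).
Proof.
move=> [f bf <-] [g bg <-]; exists (fun x => `|f x| + `|g x|).
  by apply: baire1D; exact: baire1_norm.
apply/seteqP; split=> x; rewrite /zero_set /=.
  move/eqP; rewrite paddr_eq0 ?normr_ge0// !normr_eq0.
  by move=> /andP[/eqP -> /eqP ->].
by move=> [-> ->]; rewrite normr0 addr0.
Qed.

(** With [m] the smaller of the two radii, [f^2 + g^2 <= m^2] forces both [|f| <= m] and [|g| <= m].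
    So the intersection contains a member of [EB I], and being a zero set it is one itself by
    [EB_superset]. *)
Lemma EB_setI I (Z1 Z2 : set X) : is_ideal I ->
  EB I Z1 -> EB I Z2 -> EB I (Z1 `&` Z2).
Proof.
move=> idI FZ1 FZ2.
have [h bh hZ] : baire1_zero_sets R X (Z1 `&` Z2).
  have zI := EB_baire1_zero_sets I idI.
  by apply: baire1_zero_setsI; exact: zI.
case: FZ1 FZ2 hZ => f If [e /= e0 <-] [g Ig [d /= d0 <-] hZ].
have sqI k : I k -> I (k \* k).
  by case: idI => IB _ _ IM Ik; apply: (IM) => //; exact: IB.
pose m := Num.min e d.
have m0 : 0 < m by rewrite lt_min e0.
rewrite -hZ; apply: (@EB_superset _ (f \* f \+ g \* g) _ (m * m)) => //.
- by apply: idealD => //; exact: sqI.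
- exact: mulr_gt0.
have le_m (a b : R) : a * a + b * b <= m * m -> `|a| <= m.
  move=> ab; rewrite -(@ler_pXn2r _ 2) ?nnegrE ?normr_ge0// ?(ltW m0)//.
  rewrite -normrX ger0_norm ?sqr_ge0// !expr2; apply: le_trans ab.
  by rewrite lerDl -expr2 sqr_ge0.
rewrite hZ => x; rewrite /EB_eps /= ger0_norm; last first.
  by rewrite addr_ge0// -expr2 sqr_ge0.
move=> fg; split.
  by apply: le_trans (le_m _ _ fg) _; rewrite ge_min lexx.
rewrite addrC in fg.
by apply: le_trans (le_m _ _ fg) _; rewrite ge_min lexx orbT.
Qed.

End BaireOneRing.

Theorem theorem3p5 (R : realType) (X : topologicalType)
  (T4X : T4_space X) (I : set (X -> R)) (properI : is_proper_ideal I) :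
  eB_filter R (EB I).
Proof.
have [idI _] := properI; have [IB I0 _ _] := idI.
split; last first.
  apply/seteqP; split=> Z.
    move=> [f If [eps eps0 <-]]; exists f; last by exists eps.
    by split=> [|d d0]; [exact: IB|exists f => //; exists d].
  by move=> [f [_ fE] [eps eps0 <-]]; exact: fE.
split=> [|||Z Z' [f If [eps eps0 <-]] [h bh <-]].
- split; first exact: EB_baire1_zero_sets.
  (* The zero function of [I] witnesses nonemptiness. *)
  by exists (EB_eps 1 (fun=> 0 : R)), (fun=> 0) => //; exists 1 => //=.
- by move=> [f If [eps eps0]]; exact: EB_eps_neq0 properI If eps0.
- by move=> Z1 Z2; exact: EB_setI.
- exact: EB_superset idI If eps0 bh.
Qed.
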